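(* Let $0\to\mathcal H\xrightarrow{i}\mathcal G\xrightarrow{\pi}\mathcal V\to 0$ be an exact sequence of abelian locally definable groups and locally definable homomorphisms. If $\mathcal V$ and $\mathcal H$ have the generic property, then $\mathcal G$ has the generic property.
   Context: Throughout, $\mathcal M$ is an o-minimal structure which is $\kappa$-saturated for a sufficiently large cardinal $\kappa$; ''definable'' means definable in $\mathcal M$ with parameters. A locally definable group is a group $\mathcal U$ whose underlying set is a countable increasing union $\bigcup_{k\in\mathbb N}X_k$ of definable subsets of a fixed $M^n$ such that for all $i,j$ the restriction of the group operation to $X_i\times X_j$ is definable; a definable subset of $\mathcal U$ is a definable set contained in some $X_k$. A map between locally definable groups is locally definable if its restriction to every definable subset is definable. A definable $X\subseteq\mathcal U$ is generic in $\mathcal U$ if $A+X=\mathcal U$ for some countable $A\subseteq\mathcal U$. An abelian locally definable group $\mathcal G$ has the generic property (with respect to $\mathcal M$) if every subgroup of $\mathcal G$ generated by a definable set contains a definable set which is generic in that subgroup. *)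

(* Defs.v *)
From HB Require Import structures.
From mathcomp Require Import all_boot all_order all_algebra.
From mathcomp Require Import boolp classical_sets functions cardinality.

Set Implicit Arguments.
Unset Strict Implicit.
Unset Printing Implicit Defensive.

Import Order.TTheory GRing.Theory.

Local Open Scope classical_set_scope.
Local Open Scope card_scope.

(* First-order languages of ordered structures. The order symbol is not listed
   among the relation symbols: it is the formula constructor [FLt] below, always
   interpreted by the order of the carrier. *)
Record language := Language {
  fun_symbol : Type;
  fun_arity : fun_symbol -> nat;
  rel_symbol : Type;
  rel_arity : rel_symbol -> nat }.

(* [term L n] and [formula L n]: the free variables are indexed by 'I_n. *)
Inductive term (L : language) (n : nat) : Type :=
| TVar of 'I_n
| TApp (f : fun_symbol L) of ('I_(fun_arity f) -> term L n).

(* [FAll] binds variable 0 and shifts the other variables by one. *)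
Inductive formula (L : language) : nat -> Type :=
| FFalse n : formula L n
| FEq n of term L n & term L n : formula L n
| FLt n of term L n & term L n : formula L n
| FRel n (r : rel_symbol L) of ('I_(rel_arity r) -> term L n) : formula L n
| FImp n of formula L n & formula L n : formula L n
| FAll n of formula L n.+1 : formula L n.

Record structure (L : language) (M : Type) := Structure {
  fun_interp : forall f : fun_symbol L, (fun_arity f).-tuple M -> M;
  rel_interp : forall r : rel_symbol L, set ((rel_arity r).-tuple M) }.

Section Semantics.
Context (L : language) (d : Order.disp_t) (M : orderType d).
Variable S : structure L M.

Fixpoint eval n (v : n.-tuple M) (t : term L n) : M :=
  match t with
  | TVar i => tnth v i
  | TApp f ts => fun_interp S [tuple eval v (ts j) | j < fun_arity f]
  end.

Fixpoint holds n (phi : formula L n) : n.-tuple M -> Prop :=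
  match phi in formula _ n return n.-tuple M -> Prop with
  | FFalse _ => fun=> False
  | FEq _ t u => fun v => eval v t = eval v u
  | FLt _ t u => fun v => (eval v t < eval v u)%O
  | FRel _ r ts => fun v =>
      rel_interp S (r := r) [tuple eval v (ts j) | j < rel_arity r]
  | FImp _ phi psi => fun v => holds phi v -> holds psi v
  | FAll _ phi => fun v => forall a : M, holds phi [tuple of a :: v]
  end.

(* An L(M)-formula in n variables: an L-formula phi(x, y) together with
   parameters from M to be substituted for y. *)
Record pformula (n : nat) := PFormula {
  pf_size : nat;
  pf_formula : formula L (n + pf_size);
  pf_params : pf_size.-tuple M }.

Definition pholds n (phi : pformula n) (x : n.-tuple M) : Prop :=
  holds (pf_formula phi) [tuple of x ++ pf_params phi].

Definition formula_over (A : set M) n (phi : pformula n) : Prop :=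
  forall i, A (tnth (pf_params phi) i).

Definition definable n (X : set (n.-tuple M)) : Prop :=
  exists phi : pformula n, X = [set x | pholds phi x].

(* Points are the degenerate closed intervals `[a, a]; the bounds of an
   [interval M] are in M, -oo or +oo. The linear order of M is not required to
   be dense or without endpoints. *)
Definition o_minimal : Prop :=
  forall X : set (1.-tuple M), definable X ->
    exists s : seq (interval M),
      X = [set x | exists2 I, I \in s & thead x \in I].

Definition is_type (A : set M) n (p : set (pformula n)) : Prop :=
  p `<=` formula_over A (n := n) /\
  forall q, q `<=` p -> finite_set q ->
    exists x : n.-tuple M, forall phi, q phi -> pholds phi x.

Definition realized n (p : set (pformula n)) : Prop :=
  exists x : n.-tuple M, forall phi, p phi -> pholds phi x.

Definition card_lt T U (A : set T) (B : set U) : Prop :=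
  (A #<= B) /\ ~ (B #<= A).

(* The cardinal kappa is given by a type K of that cardinality. *)
Definition saturated (K : Type) : Prop :=
  forall (A : set M), card_lt A [set: K] ->
  forall n (p : set (pformula n)), is_type A p -> realized p.

End Semantics.

Section LocallyDefinable.
Local Open Scope ring_scope.
Context (L : language) (d : Order.disp_t) (M : orderType d).
Variable S : structure L M.

(* Abelian locally definable groups. The injection [ld_val] identifies the
   group with its underlying subset of M^n. A map is definable when its graph
   is, here the graph of addition on X_i x X_j. *)
Record ldgroup := LDGroup {
  ld_sort :> zmodType;
  ld_dim : nat;
  ld_val : ld_sort -> ld_dim.-tuple M;
  ld_piece : nat -> set (ld_dim.-tuple M);
  ld_val_inj : injective ld_val;
  ld_piece_definable : forall k, definable S (ld_piece k);
  ld_piece_incr : forall i j, (i <= j)%N -> ld_piece i `<=` ld_piece j;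
  ld_range : range ld_val = \bigcup_k ld_piece k;
  ld_add_definable : forall i j,
    definable S [set [tuple of ld_val a ++ ld_val b ++ ld_val (a + b)] |
      a in ld_val @^-1` ld_piece i & b in ld_val @^-1` ld_piece j] }.

Arguments ld_val {G} x : rename.
Arguments ld_piece G k _ : clear implicits, rename.

Definition definable_subset (G : ldgroup) (X : set G) : Prop :=
  definable S (ld_val @` X) /\ exists k, ld_val @` X `<=` ld_piece G k.

Definition locally_definable (G H : ldgroup) (f : G -> H) : Prop :=
  forall X : set G, definable_subset X ->
    definable S [set [tuple of ld_val x ++ ld_val (f x)] | x in X].

Definition generated (G : zmodType) (X : set G) : set G :=
  smallest [set U : set G | zmod_closed [in U]] X.

(* Genericity in a subgroup U. *)
Definition generic (G : ldgroup) (U Y : set G) : Prop :=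
  [/\ definable_subset Y, Y `<=` U &
    exists A : set G, [/\ countable A, A `<=` U &
      [set a + y | a in A & y in Y] = U]].

Definition generic_property (G : ldgroup) : Prop :=
  forall X : set G, definable_subset X ->
    exists Y : set G, generic (generated X) Y.

Definition short_exact (H G V : zmodType) (i : H -> G) (p : G -> V) : Prop :=
  [/\ injective i, range i = [set g | p g = 0] & range p = [set: V]].

End LocallyDefinable.

(* Main.v *)
(* Let X be a definable subset of G. A definable generic set of <p(X)> is, by
   saturation, contained in p(T) for some symmetric iterated difference set T
   of X. Finitely many translates of p(T) then cover p(T + T), so
   T + T <= F + T + B with F <= <X> finite and B a definable subset of
   <X> with p(B) = 0. Hence <X> = <F> + T + <B>, although the intersection of
   ker p with <X> need not be generated by a definable set. If Z is generic in
   the subgroup <B> of i(H), then T + Z is generic in <X>, because <F> is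
   countable. *)
Require Import Defs.
From mathcomp Require Import all_boot all_order all_algebra.
From mathcomp Require Import boolp classical_sets functions cardinality.

Set Implicit Arguments.
Unset Strict Implicit.
Unset Printing Implicit Defensive.

Import Order.TTheory GRing.Theory.

Local Open Scope classical_set_scope.
Local Open Scope card_scope.
Local Open Scope ring_scope.

(** * Renaming of variables in formulas *)

Section Renaming.
Context (L : language) (d : Order.disp_t) (M : orderType d).
Context (S : structure L M).

Fixpoint term_rename n m (f : 'I_n -> 'I_m) (t : term L n) : term L m :=
  match t with
  | TVar i => TVar L (f i)
  | TApp s ts => TApp (fun j => term_rename f (ts j))
  end.

Definition lift_renaming n m (f : 'I_n -> 'I_m) (i : 'I_n.+1) : 'I_m.+1 :=
  if unlift ord0 i is Some j then lift ord0 (f j) else ord0.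

(** The target arity and the renaming come after the formula because the recursive call under [FAll]
    changes both. *)
Fixpoint formula_rename n (phi : formula L n) :
    forall m, ('I_n -> 'I_m) -> formula L m :=
  match phi in formula _ n return forall m, ('I_n -> 'I_m) -> formula L m with
  | FFalse _ => fun m _ => FFalse L m
  | FEq _ t u => fun m f => FEq (term_rename f t) (term_rename f u)
  | FLt _ t u => fun m f => FLt (term_rename f t) (term_rename f u)
  | FRel _ r ts => fun m f => FRel (fun j => term_rename f (ts j))
  | FImp _ phi psi => fun m f =>
      FImp (formula_rename phi f) (formula_rename psi f)
  | FAll _ phi => fun m f => FAll (formula_rename phi (lift_renaming f))
  end.

Definition reindex n m (f : 'I_n -> 'I_m) (v : m.-tuple M) : n.-tuple M :=
  [tuple tnth v (f i) | i < n].

Lemma eval_rename n m (f : 'I_n -> 'I_m) v t :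
  eval S v (term_rename f t) = eval S (reindex f v) t.
Proof.
elim: t => [i|s ts IH] /=; first by rewrite tnth_mktuple.
by congr (fun_interp S _); apply: eq_mktuple => j; apply: IH.
Qed.

Lemma reindex_lift n m (f : 'I_n -> 'I_m) (a : M) (v : m.-tuple M) :
  reindex (lift_renaming f) [tuple of a :: v] = [tuple of a :: reindex f v].
Proof.
apply: eq_from_tnth => i; rewrite tnth_mktuple /lift_renaming.
case: unliftP => [j ->|->]; last by rewrite !(tnth_nth a).
by have := tnth_mktuple (fun i => tnth v (f i)) j; rewrite !(tnth_nth a) => /= ->.
Qed.

(** The induction runs over all renamings at once. In the quantifier case, prepending the bound
    value commutes with reindexing, by [reindex_lift]. *)
Lemma holds_rename n (phi : formula L n) m (f : 'I_n -> 'I_m) v :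
  holds S (formula_rename phi f) v <-> holds S phi (reindex f v).
Proof.
elim: phi m f v => {n} [n|n t u|n t u|n r ts|n phi IH psi IH'|n phi IH] m f v //=.
- by rewrite !eval_rename.
- by rewrite !eval_rename.
- suff -> : [tuple eval S v (term_rename f (ts j)) | j < rel_arity r] =
    [tuple eval S (reindex f v) (ts j) | j < rel_arity r] by [].
  by apply: eq_mktuple => j; apply: eval_rename.
- by rewrite IH IH'.
- by split=> h a; have := h a; rewrite IH reindex_lift.
Qed.

End Renaming.

(** * Maps of tuples that copy coordinates *)

Section Selectors.
Context (T : Type).

Definition tuple_left a b (v : (a + b).-tuple T) : a.-tuple T :=
  [tuple tnth v (lshift b i) | i < a].
Definition tuple_right a b (v : (a + b).-tuple T) : b.-tuple T :=
  [tuple tnth v (rshift a i) | i < b].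

Arguments tuple_left : simpl never.
Arguments tuple_right : simpl never.

Lemma tuple_leftK a b (v : a.-tuple T) (w : b.-tuple T) :
  tuple_left [tuple of v ++ w] = v.
Proof. by apply: eq_from_tnth => i; rewrite tnth_mktuple tnth_lshift. Qed.

Lemma tuple_rightK a b (v : a.-tuple T) (w : b.-tuple T) :
  tuple_right [tuple of v ++ w] = w.
Proof. by apply: eq_from_tnth => i; rewrite tnth_mktuple tnth_rshift. Qed.

(** Projections, block permutations and diagonals are all of this kind. The index map is kept
    existential: the closure lemmas build it, and only its existence matters when it is turned into
    a renaming of variables. *)
Definition selector m n (g : m.-tuple T -> n.-tuple T) : Prop :=
  exists f : 'I_n -> 'I_m, forall v i, tnth (g v) i = tnth v (f i).

Lemma selector_id m : selector (@id (m.-tuple T)).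
Proof. by exists id. Qed.

Lemma selector_left m a b (g : m.-tuple T -> (a + b).-tuple T) :
  selector g -> selector (fun v => tuple_left (g v)).
Proof.
by move=> [f fg]; exists (fun i => f (lshift b i)) => v i; rewrite tnth_mktuple fg.
Qed.

Lemma selector_right m a b (g : m.-tuple T -> (a + b).-tuple T) :
  selector g -> selector (fun v => tuple_right (g v)).
Proof.
by move=> [f fg]; exists (fun i => f (rshift a i)) => v i; rewrite tnth_mktuple fg.
Qed.

Lemma selector_cat m a b (g : m.-tuple T -> a.-tuple T)
    (h : m.-tuple T -> b.-tuple T) :
  selector g -> selector h -> selector (fun v => [tuple of g v ++ h v]).
Proof.
move=> [f fg] [f' fh].
exists (fun i => match fintype.split i with inl j => f j | inr j => f' j end).
move=> v i.
by case: split_ordP => j ->; rewrite ?tnth_lshift ?tnth_rshift ?fg ?fh.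
Qed.

End Selectors.

Arguments tuple_left : simpl never.
Arguments tuple_right : simpl never.

(** * Closure properties of definable sets *)

Section Definable.
Context (L : language) (d : Order.disp_t) (M : orderType d).
Context (S : structure L M).

Lemma definableI n (X Y : set (n.-tuple M)) :
  definable S X -> definable S Y -> definable S (X `&` Y).
Proof.
move=> [[a phi u] ->] [[b psi w] ->].
(* The common formula receives [x] followed by both parameter tuples [u] and [w]; the two selectors
   recover [x ++ u] and [x ++ w] from it. *)
have sl : @selector M (n + (a + b)) _
    (fun v => [tuple of tuple_left v ++ tuple_left (tuple_right v)]).
  apply: selector_cat; first exact/selector_left/selector_id.
  exact/selector_left/selector_right/selector_id.
have sr : @selector M (n + (a + b)) _
    (fun v => [tuple of tuple_left v ++ tuple_right (tuple_right v)]).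
  apply: selector_cat; first exact/selector_left/selector_id.
  exact/selector_right/selector_right/selector_id.
case: sl sr => [f fE] [g gE].
(* Conjunction is expressed by implication and falsity alone, hence the classical reasoning
   below. *)
pose chi := FImp (FImp (formula_rename phi f)
  (FImp (formula_rename psi g) (FFalse L _))) (FFalse L _).
exists (PFormula chi [tuple of u ++ w]); apply/seteqP.
have E (x : n.-tuple M) : holds S chi [tuple of x ++ [tuple of u ++ w]] <->
   (holds S phi [tuple of x ++ u] /\ holds S psi [tuple of x ++ w]).
  rewrite /= !holds_rename.
  have -> : reindex f [tuple of x ++ [tuple of u ++ w]] = [tuple of x ++ u].
    apply: eq_from_tnth => i.
    by rewrite tnth_mktuple -fE tuple_rightK !tuple_leftK.
  have -> : reindex g [tuple of x ++ [tuple of u ++ w]] = [tuple of x ++ w].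
    apply: eq_from_tnth => i.
    by rewrite tnth_mktuple -gE !tuple_rightK !tuple_leftK.
  split; last by tauto.
  by move=> h; split; apply: contrapT; tauto.
by split=> x; [exact: (E x).2 | exact: (E x).1].
Qed.

Lemma definableC n (X : set (n.-tuple M)) :
  definable S X -> definable S (~` X).
Proof.
by move=> [[a phi u] ->]; exists (PFormula (FImp phi (FFalse L _)) u).
Qed.

Lemma definableU n (X Y : set (n.-tuple M)) :
  definable S X -> definable S Y -> definable S (X `|` Y).
Proof.
move=> dX dY; rewrite -[X `|` Y]setCK setCU.
by apply/definableC/definableI; apply: definableC.
Qed.

Lemma definable0 n : definable S (@set0 (n.-tuple M)).
Proof.
by exists (PFormula (FFalse L (n + 0)) [tuple]); rewrite eqEsubset; split.
Qed.

Lemma definable_selector n m (X : set (n.-tuple M))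
    (g : m.-tuple M -> n.-tuple M) :
  selector g -> definable S X -> definable S (g @^-1` X).
Proof.
move=> sg [[a phi u] ->].
have : @selector M (m + a) _
    (fun v => [tuple of g (tuple_left v) ++ tuple_right v]).
  apply: selector_cat; last exact/selector_right/selector_id.
  case: sg => f fE; exists (fun i => lshift a (f i)) => v i.
  by rewrite fE tnth_mktuple.
move=> [f fE]; exists (PFormula (formula_rename phi f) u).
apply/seteqP; rewrite /pholds /=.
have E (x : _.-tuple M) : reindex f [tuple of x ++ u] = [tuple of g x ++ u].
  by apply: eq_from_tnth => i; rewrite tnth_mktuple -fE tuple_leftK tuple_rightK.
by split=> x /=; rewrite holds_rename E.
Qed.

(** The fixed coordinates [w] are moved into the parameters of the formula. *)
Lemma definable_fibre n k (X : set ((k + n).-tuple M)) (w : k.-tuple M) :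
  definable S X -> definable S [set v : n.-tuple M | X [tuple of w ++ v]].
Proof.
move=> [[a phi u] ->].
have : @selector M (n + (k + a)) _ (fun v => [tuple of
    [tuple of tuple_left (tuple_right v) ++ tuple_left v] ++
    tuple_right (tuple_right v)]).
  apply: selector_cat; last exact/selector_right/selector_right/selector_id.
  apply: selector_cat; last exact/selector_left/selector_id.
  exact/selector_left/selector_right/selector_id.
move=> [f fE]; exists (PFormula (formula_rename phi f) [tuple of w ++ u]).
apply/seteqP; rewrite /pholds /=.
have E (x : _.-tuple M) : reindex f [tuple of x ++ [tuple of w ++ u]] =
    [tuple of [tuple of w ++ x] ++ u].
  apply: eq_from_tnth => i.
  by rewrite tnth_mktuple -fE !(tuple_leftK, tuple_rightK).
by split=> x /=; rewrite holds_rename E.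
Qed.

Lemma definable_forall1 n (X : set (n.+1.-tuple M)) :
  definable S X -> definable S [set v : n.-tuple M | forall a, X [tuple of a :: v]].
Proof.
move=> [[k phi u] ->].
exists (@PFormula _ _ _ n k (@FAll L (n + k) phi) u).
rewrite /pholds /=; apply/seteqP.
have E (x : n.-tuple M) a : [tuple of [tuple of a :: x] ++ u] =
    [tuple of a :: [tuple of x ++ u]] by apply: val_inj.
by split=> x /= h a; have := h a; rewrite E.
Qed.

Lemma definable_exists n k (X : set ((k + n).-tuple M)) :
  definable S X ->
  definable S [set v : n.-tuple M | exists w : k.-tuple M, X [tuple of w ++ v]].
Proof.
elim: k X => [|k IH] X dX.
  rewrite (_ : [set v | _] = X) //; apply/seteqP; split=> v.
    by move=> [w]; rewrite (tuple0 w); congr X; apply: val_inj.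
  by move=> Xv; exists [tuple]; move: Xv; congr X; apply: val_inj.
(* [Y] projects away the first coordinate of [X]; the existential quantifier is written as a doubly
   negated universal one. *)
pose Y : set ((k + n).-tuple M) := ~` [set v : (k + n).-tuple M |
  forall a : M, (~` X) [tuple of a :: v]].
have dY : definable S Y by apply/definableC/definable_forall1/definableC.
rewrite (_ : [set v | _] =
  [set v : n.-tuple M | exists w : k.-tuple M, Y [tuple of w ++ v]]).
  exact: IH.
apply/seteqP; split=> v /=.
  move=> [w Xw]; exists [tuple of behead w] => /(_ (thead w)); apply.
  move: Xw; congr X; apply: val_inj => /=.
  by rewrite [in LHS](tuple_eta w).
move=> [w /existsNP[a /contrapT Xa]]; exists [tuple of a :: w].
by move: Xa; congr X; apply: val_inj.
Qed.

End Definable.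

Arguments ld_val {L d M S G} x : rename.
Arguments ld_piece {L d M S} G k _ : rename.

(** * Saturation as compactness of countable definable covers *)

Section Compactness.
Context (L : language) (d : Order.disp_t) (M : orderType d).
Context (S : structure L M).

Definition countably_compact : Prop :=
  forall n (D : set (n.-tuple M)) (E : nat -> set (n.-tuple M)),
    definable S D -> (forall k, definable S (E k)) ->
    (forall i j, (i <= j)%N -> E i `<=` E j) ->
    D `<=` \bigcup_k E k -> exists k, D `<=` E k.

Lemma countable_card_lt T (A : set T) K :
  countable A -> card_lt [set: nat] [set: K] -> card_lt A [set: K].
Proof.
move=> cA [leK nleK]; split; first exact: card_le_trans leK.
by move=> KA; apply: nleK; exact: card_le_trans KA cA.
Qed.

Lemma finite_nat_bounded (A : set nat) :
  finite_set A -> exists N, forall i, A i -> (i <= N)%N.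
Proof.
move=> /finite_seqP[s ->]; exists (\max_(i <- s) i)%N => i /= si.
exact: (@leq_bigmax_seq _ s xpredT id).
Qed.

(** If no [E k] contained [D], the formulas defining the sets [D] minus [E k] would form a type over
    their countably many parameters: as [E] increases, finitely many of them follow from the one of
    largest index. A realization would lie in [D] but in no [E k]. *)
Lemma saturated_countably_compact K :
  card_lt [set: nat] [set: K] -> saturated S K -> countably_compact.
Proof.
move=> K_unc S_sat n D E dD dE E_incr DE; apply: contrapT => /forallNP nDE.
have ephi k : exists phi : pformula L M n, D `&` ~` E k = [set x | pholds S phi x].
  by have [phi ->] := definableI dD (definableC (dE k)); exists phi.
have {ephi}[phi phiE] := boolp.choice ephi.
have phiP k x : pholds S (phi k) x <-> D x /\ ~ E k x.
  by have /seteqP[h1 h2] := phiE k; split=> h; [exact: h2|exact: h1].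
pose A := \bigcup_k range (tnth (pf_params (phi k))).
have cA : countable A.
  apply: bigcup_countable => // k _.
  by apply: card_le_trans (card_image_le _ _) _; exact: countableP.
have [|x xphi] := S_sat A (countable_card_lt cA K_unc) n (range phi).
  split=> [_ [k _ <-] j|q qphi fq]; first by exists k => //; exists j.
  (* Each formula of the finite set [q] gets an index, with 0 as default outside [q]; the bound [N]
     on these indices then gives one point satisfying all of [q]. *)
  have ef c : exists k, q c -> phi k = c.
    case: (pselect (q c)) => [/qphi[k _ <-]|nq]; first by exists k.
    by exists 0%N.
  have {ef}[f fP] := boolp.choice ef.
  have [N NP] := finite_nat_bounded (finite_image f fq).
  have /existsNP[x /not_implyP[Dx nEx]] := nDE N.
  exists x => c qc; rewrite -(fP c qc); apply/phiP; split=> // Ex.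
  by apply: nEx; apply: E_incr Ex; apply: NP; exists c.
have Dx : D x by have /phiP[] : pholds S (phi 0%N) x by apply: xphi; exists 0%N.
have [k _ Ex] := DE _ Dx.
by have /phiP[] : pholds S (phi k) x by apply: xphi; exists k.
Qed.

End Compactness.

(** * Definable subsets of a locally definable group *)

Section DefinableSubsets.
Context (L : language) (d : Order.disp_t) (M : orderType d).
Context (S : structure L M) (S_compact : countably_compact S).

Definition ld_part (G : ldgroup S) k : set G := ld_val @^-1` ld_piece G k.
Arguments ld_part G k _ : clear implicits.

Lemma ld_val_imageP (G : ldgroup S) (X : set G) x :
  (ld_val @` X) (ld_val x) <-> X x.
Proof. by split=> [[y Xy /ld_val_inj <-]|Xx]; last exists x. Qed.

Lemma ld_part_incr (G : ldgroup S) i j :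
  (i <= j)%N -> ld_part G i `<=` ld_part G j.
Proof. by move=> ij x; exact: ld_piece_incr. Qed.

Lemma ld_part_cover (G : ldgroup S) (x : G) : exists k, ld_part G k x.
Proof.
have : (\bigcup_k ld_piece G k) (ld_val x) by rewrite -ld_range; exists x.
by move=> [k _ kx]; exists k.
Qed.

Lemma definable_subset_part (G : ldgroup S) k : definable_subset (ld_part G k).
Proof.
suff E : ld_val @` ld_part G k = ld_piece G k.
  by split; [rewrite E; exact: ld_piece_definable|exists k; rewrite E].
apply/seteqP; split=> [_ [x kx <-]//|v kv].
have [x _ xv] : range (@ld_val _ _ _ _ G) v by rewrite ld_range; exists k.
by exists x => //; rewrite /ld_part /preimage /= xv.
Qed.

Lemma definable_subset_sub_part (G : ldgroup S) (X : set G) :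
  definable_subset X -> exists k, X `<=` ld_part G k.
Proof. by move=> [_ [k Xk]]; exists k => x Xx; apply: Xk; exists x. Qed.

(** Containment in a single piece is automatic: the pieces increase and cover the group, so
    compactness applies. *)
Lemma definable_subset_of_val (G : ldgroup S) (X : set G) :
  definable S (ld_val @` X) -> definable_subset X.
Proof.
move=> dX; split=> //; apply: S_compact => //.
- exact: ld_piece_definable.
- exact: ld_piece_incr.
- by move=> _ [x _ <-]; rewrite -ld_range; exists x.
Qed.

Lemma definable_subset_compact (G : ldgroup S) (X : set G) (E : nat -> set G) :
  definable_subset X -> (forall k, definable_subset (E k)) ->
  (forall i j, (i <= j)%N -> E i `<=` E j) ->
  X `<=` \bigcup_k E k -> exists k, X `<=` E k.
Proof.
move=> [dX _] dE E_incr XE.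
have [|||k Xk] := S_compact (D := ld_val @` X)
  (E := fun k => ld_val @` E k) dX.
- by move=> k; have [] := dE k.
- by move=> i j ij _ [x Ex <-]; exists x => //; exact: E_incr Ex.
- by move=> _ [x /XE[k _ Ex] <-]; exists k => //; exists x.
by exists k => x Xx; apply/ld_val_imageP/Xk; exists x.
Qed.

Lemma definable_subset0 (G : ldgroup S) : definable_subset (@set0 G).
Proof.
by apply: definable_subset_of_val; rewrite image_set0; exact: definable0.
Qed.

Lemma definable_subsetU (G : ldgroup S) (X Y : set G) :
  definable_subset X -> definable_subset Y -> definable_subset (X `|` Y).
Proof.
move=> [dX _] [dY _]; apply: definable_subset_of_val.
by rewrite image_setU; exact: definableU.
Qed.

Definition add_graph (G : ldgroup S) (X Y : set G) :
    set ((ld_dim G + (ld_dim G + ld_dim G)).-tuple M) :=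
  [set [tuple of ld_val a ++ ld_val b ++ ld_val (a + b)] | a in X & b in Y].

Lemma add_graphP (G : ldgroup S) (X Y : set G) (u v w : (ld_dim G).-tuple M) :
  add_graph X Y [tuple of u ++ [tuple of v ++ w]] <->
  exists a b, [/\ X a, Y b, ld_val a = u, ld_val b = v & ld_val (a + b) = w].
Proof.
split=> [[a Xa [b Yb E]]|[a [b [Xa Yb <- <- <-]]]]; last first.
  by exists a => //; exists b.
exists a, b; split=> //.
- by have := congr1 (@tuple_left _ _ _) E; rewrite !tuple_leftK.
- have := congr1 (fun t => tuple_left (tuple_right t)) E.
  by rewrite /= !tuple_rightK !tuple_leftK.
- have := congr1 (fun t => tuple_right (tuple_right t)) E.
  by rewrite /= !tuple_rightK.
Qed.

(** The graph over two pieces containing [X] and [Y] is cut down by conditions on its first two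
    blocks of coordinates. *)
Lemma definable_add_graph (G : ldgroup S) (X Y : set G) :
  definable_subset X -> definable_subset Y -> definable S (add_graph X Y).
Proof.
move=> dX dY; have [i Xi] := definable_subset_sub_part dX.
have [j Yj] := definable_subset_sub_part dY.
move: dX dY => [dX _] [dY _].
have sl : selector (fun v : (ld_dim G + (ld_dim G + ld_dim G)).-tuple M =>
  tuple_left v) by exact/selector_left/selector_id.
have sr : selector (fun v : (ld_dim G + (ld_dim G + ld_dim G)).-tuple M =>
  tuple_left (tuple_right v)) by exact/selector_left/selector_right/selector_id.
rewrite (_ : add_graph X Y = add_graph (ld_part G i) (ld_part G j) `&`
  ((fun v => tuple_left v) @^-1` (ld_val @` X) `&`
   (fun v => tuple_left (tuple_right v)) @^-1` (ld_val @` Y))).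
  apply: definableI; first exact: ld_add_definable.
  by apply: definableI; exact: definable_selector.
apply/seteqP; split=> [_ [a Xa [b Yb <-]]|_ [[a _ [b _ <-]]]] /=.
  split; first by exists a; [exact: Xi|exists b; [exact: Yj|]].
  by rewrite tuple_rightK !tuple_leftK; split; apply/ld_val_imageP.
rewrite tuple_rightK !tuple_leftK => -[/ld_val_imageP Xa /ld_val_imageP Yb].
by exists a => //; exists b.
Qed.

(** The sumset is the projection of the graph of addition to its last block. *)
Lemma definable_subsetD (G : ldgroup S) (X Y : set G) :
  definable_subset X -> definable_subset Y ->
  definable_subset [set a + b | a in X & b in Y].
Proof.
move=> dX dY; apply: definable_subset_of_val.
have := definable_exists (definable_exists (definable_add_graph dX dY)).
congr (definable S _); apply/seteqP; split=> [w [b [a /add_graphP]]|].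
  move=> [a' [b' [Xa Yb _ _ <-]]]; exists (a' + b') => //.
  by exists a' => //; exists b'.
move=> _ [_ [a Xa [b Yb <-]] <-]; exists (ld_val b), (ld_val a).
by apply/add_graphP; exists a, b.
Qed.

(** The fibre of the graph of addition over the pair [0], [x] is the single point [0 + x]. *)
Lemma definable_subset1 (G : ldgroup S) (x : G) : definable_subset [set x].
Proof.
have [i i0] := ld_part_cover (0 : G); have [j jx] := ld_part_cover x.
apply: definable_subset_of_val.
have := definable_fibre (ld_val x) (definable_fibre (ld_val 0)
  (definable_add_graph (definable_subset_part G i) (definable_subset_part G j))).
congr (definable S _); apply/seteqP; split=> [w /add_graphP|].
  move=> [a [b [_ _ /ld_val_inj -> /ld_val_inj -> <-]]].
  by exists x; rewrite ?add0r.
move=> _ [_ -> <-]; apply/add_graphP.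
by exists 0, x; rewrite add0r; split.
Qed.

Lemma finite_definable_subset (G : ldgroup S) (X : set G) :
  finite_set X -> definable_subset X.
Proof.
move=> /finite_seqP[s ->]; elim: s => [|x s IH].
  by rewrite set_nil; exact: definable_subset0.
rewrite (_ : [set` x :: s] = [set x] `|` [set` s]).
  by apply: definable_subsetU => //; exact: definable_subset1.
apply/seteqP; split=> y /=; rewrite inE; first by case/predU1P; [left|right].
by move=> [->|sy]; rewrite ?eqxx ?sy ?orbT.
Qed.

(** Negation is read off the graph of addition as the pairs with sum 0. That graph is available only
    over definable sets, so the negatives must first be bounded: the sets [E j] increase and cover
    [X], and compactness gives one [j]. *)
Lemma definable_subsetN (G : ldgroup S) (X : set G) :
  definable_subset X -> definable_subset [set - x | x in X].
Proof.
move=> dX; pose g j := add_graph X (ld_part G j).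
have dg j : definable S (g j).
  exact: definable_add_graph (definable_subset_part G j).
pose E j : set G := [set a | X a /\ ld_part G j (- a)].
have [|||j Xj] := definable_subset_compact (E := E) dX.
- move=> j; apply: definable_subset_of_val.
  (* Fibres and projections act on leading blocks, so the blocks are reordered as sum, [b], [a]: the
     sum is set to 0, [b] is projected away and [a] remains. *)
  have s : selector (fun v : (ld_dim G + (ld_dim G + ld_dim G)).-tuple M =>
      [tuple of tuple_right (tuple_right v) ++
        [tuple of tuple_left (tuple_right v) ++ tuple_left v]]).
    apply: selector_cat; first exact/selector_right/selector_right/selector_id.
    apply: selector_cat; first exact/selector_left/selector_right/selector_id.
    exact/selector_left/selector_id.
  have := definable_exists
    (definable_fibre (ld_val 0) (definable_selector s (dg j))).
  congr (definable S _); apply/seteqP; split=> [v [w]|].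
    rewrite /preimage /mkset !(tuple_rightK, tuple_leftK).
    move=> /add_graphP[a [b [Xa jb <- _ /ld_val_inj/eqP]]].
    rewrite addrC addr_eq0 => /eqP bE; exists a => //; split=> //.
    by rewrite -bE.
  move=> _ [a [Xa ja] <-]; exists (ld_val (- a)).
  rewrite /preimage /mkset !(tuple_rightK, tuple_leftK); apply/add_graphP.
  by exists a, (- a); rewrite subrr; split.
- by move=> i j ij a [Xa ia]; split=> //; exact: ld_part_incr ia.
- by move=> a Xa; have [k ka] := ld_part_cover (- a); exists k.
apply: definable_subset_of_val.
(* The order is now sum, [a], [b], so that [b], the negative of [a], is what remains. *)
have s : selector (fun v : (ld_dim G + (ld_dim G + ld_dim G)).-tuple M =>
    [tuple of tuple_left (tuple_right v) ++
      [tuple of tuple_right (tuple_right v) ++ tuple_left v]]).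
  apply: selector_cat; first exact/selector_left/selector_right/selector_id.
  apply: selector_cat; first exact/selector_right/selector_right/selector_id.
  exact/selector_left/selector_id.
have := definable_exists
  (definable_fibre (ld_val 0) (definable_selector s (dg j))).
congr (definable S _); apply/seteqP; split=> [v [w]|].
  rewrite /preimage /mkset !(tuple_rightK, tuple_leftK).
  move=> /add_graphP[a [b [Xa _ _ <- /ld_val_inj/eqP]]].
  by rewrite addrC addr_eq0 => /eqP ->; exists (- a) => //; exists a.
move=> _ [_ [a Xa <-] <-]; exists (ld_val a).
rewrite /preimage /mkset !(tuple_rightK, tuple_leftK); apply/add_graphP.
by exists a, (- a); rewrite subrr; split=> //; case: (Xj _ Xa).
Qed.

Lemma definable_subsetB (G : ldgroup S) (X Y : set G) :
  definable_subset X -> definable_subset Y ->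
  definable_subset [set a - b | a in X & b in Y].
Proof.
move=> dX dY; have := definable_subsetD dX (definable_subsetN dY).
congr definable_subset; apply/seteqP; split=> x [a Xa].
  by move=> [_ [b Yb <-] <-{x}]; exists a => //; exists b.
by move=> [b Yb <-{x}]; exists a => //; exists (- b) => //; exists b.
Qed.

(** * Images, fibres and preimages under locally definable maps *)

Section LocallyDefinableMaps.
Context (G H : ldgroup S) (f : G -> H) (f_ld : locally_definable f).

Definition map_graph (X : set G) : set ((ld_dim G + ld_dim H).-tuple M) :=
  [set [tuple of ld_val x ++ ld_val (f x)] | x in X].

Lemma map_graphP (X : set G) (u : (ld_dim G).-tuple M)
    (v : (ld_dim H).-tuple M) : map_graph X [tuple of u ++ v] <->
  exists x, [/\ X x, ld_val x = u & ld_val (f x) = v].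
Proof.
split=> [[x Xx E]|[x [Xx <- <-]]]; last by exists x.
exists x; split=> //.
- by have := congr1 (@tuple_left _ _ _) E; rewrite !tuple_leftK.
- by have := congr1 (@tuple_right _ _ _) E; rewrite !tuple_rightK.
Qed.

Lemma definable_subset_image (X : set G) :
  definable_subset X -> definable_subset (f @` X).
Proof.
move=> dX; apply: definable_subset_of_val.
have := definable_exists (f_ld dX).
congr (definable S _); apply/seteqP; split=> [v [u /map_graphP]|].
  by move=> [x [Xx _ <-]]; exists (f x) => //; exists x.
by move=> _ [_ [x Xx <-] <-]; exists (ld_val x); apply/map_graphP; exists x.
Qed.

Lemma definable_subset_level (X : set G) (y : H) :
  definable_subset X -> definable_subset [set x | X x /\ f x = y].
Proof.
move=> dX; apply: definable_subset_of_val.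
have s : selector (fun v : (ld_dim H + ld_dim G).-tuple M =>
    [tuple of tuple_right v ++ tuple_left v]).
  by apply: selector_cat; [apply: selector_right|apply: selector_left];
    exact: selector_id.
have := definable_fibre (ld_val y) (definable_selector s (f_ld dX)).
congr (definable S _); apply/seteqP; split=> [v|].
  rewrite /preimage /mkset tuple_rightK tuple_leftK.
  by move=> /map_graphP[x [Xx <- /ld_val_inj fx]]; exists x.
move=> _ [x [Xx <-] <-]; rewrite /preimage /mkset tuple_rightK tuple_leftK.
by apply/map_graphP; exists x.
Qed.

(** Compactness puts [Y] inside the image of one piece of [G]. By injectivity the whole preimage
    lies in that piece, where the graph of [f] is definable. *)
Lemma definable_subset_preimage (Y : set H) :
  injective f -> Y `<=` range f -> definable_subset Y ->
  definable_subset (f @^-1` Y).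
Proof.
move=> f_inj Yf dY.
have [|||k Yk] := definable_subset_compact (E := fun k => f @` ld_part G k) dY.
- by move=> k; apply: definable_subset_image; exact: definable_subset_part.
- by move=> i j ij _ [x ix <-]; exists x => //; exact: ld_part_incr ix.
- move=> y /Yf[x _ <-]; have [k kx] := ld_part_cover x.
  by exists k => //; exists x.
apply: definable_subset_of_val.
have s : selector (fun v : (ld_dim H + ld_dim G).-tuple M =>
    [tuple of tuple_right v ++ tuple_left v]).
  by apply: selector_cat; [apply: selector_right|apply: selector_left];
    exact: selector_id.
have s' : selector (fun v : (ld_dim H + ld_dim G).-tuple M => tuple_left v).
  exact/selector_left/selector_id.
have := definable_exists (definableI (definable_selector s' dY.1)
  (definable_selector s (f_ld (definable_subset_part G k)))).
congr (definable S _); apply/seteqP; split=> [v [w []]|].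
  rewrite /preimage /mkset tuple_rightK tuple_leftK => Yw /map_graphP[x [_ <- fx]].
  by exists x => //; move: Yw; rewrite -fx => /ld_val_imageP.
move=> _ [x Yx <-]; exists (ld_val (f x)).
rewrite /setI /preimage /mkset tuple_rightK tuple_leftK.
split; first by apply/ld_val_imageP.
apply/map_graphP; exists x; split=> //.
by have [x' kx' /f_inj <-] := Yk _ Yx.
Qed.

End LocallyDefinableMaps.
End DefinableSubsets.

Lemma countable_image2 T1 T2 T3 (f : T1 -> T2 -> T3) (A : set T1) (B : set T2) :
  countable A -> countable B -> countable [set f a b | a in A & b in B].
Proof.
move=> cA cB; rewrite image2E.
exact: card_le_trans (card_image_le _ _) (countableX cA cB).
Qed.

(** * Generated subgroups as unions of iterated difference sets *)

Section Generated.
Context (G : zmodType).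
Implicit Types X U : set G.

Lemma sub_generated X : X `<=` generated X.
Proof. exact: sub_gen_smallest. Qed.

Lemma generated0 X : generated X 0.
Proof. by move=> U [[/set_mem U0 _] _]. Qed.

Lemma generatedB X a b : generated X a -> generated X b -> generated X (a - b).
Proof.
move=> Xa Xb U CU; have [[_ UB] _] := CU.
by apply/set_mem/UB; apply/mem_set; [exact: Xa|exact: Xb].
Qed.

Lemma generatedN X a : generated X a -> generated X (- a).
Proof. by rewrite -[- a]sub0r; apply: generatedB; exact: generated0. Qed.

Lemma generatedD X a b : generated X a -> generated X b -> generated X (a + b).
Proof.
by move=> Xa Xb; rewrite -[b]opprK; apply: generatedB => //; exact: generatedN.
Qed.

Lemma generated_sub X U :
  U 0 -> (forall a b, U a -> U b -> U (a - b)) -> X `<=` U -> generated X `<=` U.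
Proof.
move=> U0 UB XU; apply: smallest_sub => //; split; first exact/mem_set.
by move=> a b /set_mem Ua /set_mem Ub; apply/mem_set/UB.
Qed.

(** Including 0 at the start makes the stages increase; taking differences makes every stage from 1
    on symmetric and the union a subgroup. *)
Fixpoint iter_difference X n : set G :=
  if n is m.+1
  then [set a - b | a in iter_difference X m & b in iter_difference X m]
  else 0 |` X.

Lemma iter_difference0 X n : iter_difference X n 0.
Proof. by elim: n => [|n IH]; [left|exists 0 => //; exists 0; rewrite ?subr0]. Qed.

Lemma iter_difference_incr X i j :
  (i <= j)%N -> iter_difference X i `<=` iter_difference X j.
Proof.
elim: j => [|j IH]; first by rewrite leqn0 => /eqP ->.
rewrite leq_eqVlt => /predU1P[->//|/IH ij] a /ij ja.
by exists a => //; exists 0; [exact: iter_difference0|rewrite subr0].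
Qed.

Lemma iter_differenceN X n a :
  iter_difference X n.+1 a -> iter_difference X n.+1 (- a).
Proof. by move=> [b nb [c nc <-]]; rewrite opprB; exists c => //; exists b. Qed.

(** For definable [X] the stages are definable, so this exhausts the generated subgroup by an
    increasing sequence to which compactness applies. *)
Lemma generatedE X : generated X = \bigcup_n iter_difference X n.
Proof.
apply/seteqP; split.
  apply: generated_sub; first by exists 0%N => //; left.
    move=> a b [i _ ia] [j _ jb]; exists (maxn i j).+1 => //=.
    exists a; first exact: iter_difference_incr (leq_maxl i j) _ ia.
    by exists b => //; exact: iter_difference_incr (leq_maxr i j) _ jb.
  by move=> a Xa; exists 0%N => //; right.
move=> a [n _]; elim: n a => [|n IH] a.
  by move=> [->|/sub_generated//]; exact: generated0.
by move=> [b /IH Xb [c /IH Xc <-]]; exact: generatedB.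
Qed.

Lemma countable_generated X : countable X -> countable (generated X).
Proof.
move=> cX; rewrite generatedE; apply: bigcup_countable => // n _.
elim: n => [|n IH] /=; last exact: countable_image2.
rewrite -bigcup2E; apply: bigcup_countable => // -[|[|i]] _ //=.
Qed.

(* The sumset <F> + T + <B> is stable under translation by T = -T, hence by the
   subgroup generated by T. *)
Lemma generated_cover X T F B :
  X `<=` T -> T 0 -> (forall t, T t -> T (- t)) ->
  (forall t t', T t -> T t' ->
    exists f s b, [/\ F f, T s, B b & t + t' = f + s + b]) ->
  forall x, generated X x ->
    exists f t b, [/\ generated F f, T t, generated B b & x = f + t + b].
Proof.
move=> XT T0 TN TD x.
pose W : set G := [set x | exists f t b,
  [/\ generated F f, T t, generated B b & x = f + t + b]].
have WD w t : W w -> T t -> W (w + t).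
  move=> [f [s [b [Ff Ts Bb ->]]]] Tt.
  have [f' [s' [b' [Ff' Ts' Bb' E]]]] := TD _ _ Ts Tt.
  exists (f + f'), s', (b' + b); split=> //.
  - by apply: generatedD => //; exact: sub_generated.
  - by apply: generatedD => //; exact: sub_generated.
  - by rewrite addrAC -[f + s + t]addrA E !addrA.
have W0 : W 0 by exists 0, 0, 0; rewrite !addr0; split=> //; exact: generated0.
(* [N] is the set of translations that preserve [W] in both directions; requiring both signs makes
   it closed under differences. *)
pose N : set G := [set u | forall w, W w -> W (w + u) /\ W (w - u)].
have XN : generated X `<=` N.
  apply: generated_sub => [w|a b Na Nb w /Na[Wa Wa']|a Xa w Ww].
  - by rewrite subr0 addr0.
  - split; first by rewrite addrA; have [] := Nb _ Wa.
    by rewrite opprB [b - a]addrC addrA; have [] := Nb _ Wa'.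
  - by split; apply: WD => //; last apply: TN; exact: XT.
by move=> /XN /(_ 0 W0)[]; rewrite add0r.
Qed.

End Generated.

Lemma generated_image (G H : zmodType) (f : {additive G -> H}) (X : set G) :
  generated (f @` X) = f @` generated X.
Proof.
apply/seteqP; split.
  apply: generated_sub.
  - by exists 0; [exact: generated0|rewrite raddf0].
  - move=> _ _ [a Xa <-] [b Xb <-].
    by exists (a - b); [exact: generatedB|rewrite raddfB].
  - by move=> _ [a Xa <-]; exists a => //; exact: sub_generated.
move=> _ [a + <-]; move: a; apply: generated_sub => [|a b|a Xa].
- by rewrite /= raddf0; exact: generated0.
- by rewrite /= raddfB; exact: generatedB.
- by apply: sub_generated; exists a.
Qed.

(** * The generic property of an extension *)

Section Extension.
Context (L : language) (d : Order.disp_t) (M : orderType d).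
Context (S : structure L M) (S_compact : countably_compact S).

(** An injection of [A] into the naturals exhausts [A] by finite sets [A' k]; the sumsets of these
    with [Y] are definable and increasing, and compactness selects one. *)
Lemma definable_subset_finite_cover (G : ldgroup S) (X Y A : set G) :
  definable_subset X -> definable_subset Y -> countable A ->
  X `<=` [set a + y | a in A & y in Y] ->
  exists A', [/\ finite_set A', A' `<=` A & X `<=` [set a + y | a in A' & y in Y]].
Proof.
move=> dX dY /countable_injP[f f_inj] XA.
pose A' k := [set a | A a /\ (f a <= k)%N].
have fA' k : finite_set (A' k).
  have /eq_finite_set <- : f @` A' k #= A' k.
    apply: inj_card_eq => a b /set_mem[Aa _] /set_mem[Ab _].
    by apply: f_inj; exact/mem_set.
  by apply: sub_finite_set (finite_II k.+1) => _ [a [_ ak] <-].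
have [|||k Xk] := definable_subset_compact S_compact
    (E := fun k => [set a + y | a in A' k & y in Y]) dX.
- move=> k; apply: definable_subsetD => //.
  exact: finite_definable_subset.
- move=> i j ij _ [a [Aa ai] [y Yy <-]]; exists a; last by exists y.
  by split=> //; exact: leq_trans ij.
- by move=> _ /XA[a Aa [y Yy <-]]; exists (f a) => //; exists a => //; exists y.
by exists (A' k); split=> // a [].
Qed.

Lemma definable_iter_difference (G : ldgroup S) (X : set G) n :
  definable_subset X -> definable_subset (iter_difference X n).
Proof.
move=> dX; elim: n => [|n IH] /=; last exact: definable_subsetB.
by apply: definable_subsetU => //; exact: definable_subset1.
Qed.

Lemma generic_property_extension (H G V : ldgroup S)
    (i : {additive H -> G}) (p : {additive G -> V}) :
  locally_definable i -> locally_definable p -> short_exact i p ->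
  generic_property V -> generic_property H -> generic_property G.
Proof.
move=> i_ld p_ld [i_inj i_range _] gV gH X dX.
have dp := definable_subset_image S_compact p_ld.
have [Y [dY YU [A [cA AU AY]]]] := gV _ (dp _ dX).
rewrite generated_image in YU AU AY.
have dD n := definable_iter_difference n dX.
(* The subgroup generated by the image of [X] is the union of the images of the iterated difference
   sets, so one of these images already contains [Y]. *)
have [|||n Yn] := definable_subset_compact S_compact
    (E := fun n => p @` iter_difference X n) dY.
- by move=> n; exact: dp.
- by move=> j k jk _ [x jx <-]; exists x => //; exact: iter_difference_incr jk _ jx.
- move=> _ /YU[x + <-]; rewrite generatedE => -[k _ kx].
  by exists k => //; exists x.
(* The stage after [n] is taken because symmetry is guaranteed only for successor stages. *)
pose T := iter_difference X n.+1.
have XT : X `<=` T.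
  move=> x Xx; apply: (@iter_difference_incr _ _ 0) => //; first by right.
have TU : T `<=` generated X by rewrite generatedE => x Tx; exists n.+1.
have YT : Y `<=` p @` T.
  move=> _ /Yn[x nx <-]; exists x => //.
  exact: iter_difference_incr (leqnSn n) _ nx.
have dT : definable_subset T by exact: dD.
pose TT := [set a + b | a in T & b in T].
have dTT : definable_subset TT by exact: definable_subsetD.
(* The image of [TT] lies in the image of [generated X], which is covered by the translates of [Y]
   by [A]; finitely many of them suffice. *)
have [|A' [fA' A'A TTA']] := definable_subset_finite_cover (dp _ dTT) dY cA.
  rewrite AY => _ [_ [a Ta [b Tb <-]] <-]; exists (a + b) => //.
  by apply: generatedD; exact: TU.
(* The finitely many translating elements are lifted along [p] into [generated X], with 0 as default
   outside [A']. *)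
have ex_lift v : exists g, A' v -> generated X g /\ p g = v.
  case: (pselect (A' v)) => [/A'A/AU[g Ug <-]|nA]; first by exists g.
  by exists 0.
have {ex_lift} [lift liftP] := boolp.choice ex_lift.
pose F := lift @` A'.
have fF : finite_set F by exact: finite_image.
have FU : F `<=` generated X by move=> _ [v /liftP[Uv _] <-].
pose FT := [set a + b | a in F & b in T].
have dFT : definable_subset FT.
  by apply: definable_subsetD => //; exact: finite_definable_subset.
(* [B] collects the errors left when an element of [TT] is replaced by an element of [FT] with the
   same image under [p]. Restricting to a definable difference set keeps it definable. *)
pose B := [set x | [set a - b | a in TT & b in FT] x /\ p x = 0].
have dB : definable_subset B.
  by apply: definable_subset_level => //; exact: definable_subsetB.
have Bi : B `<=` range i by rewrite i_range => x [].
have BU : B `<=` generated X.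
  move=> _ [[_ [t Tt [t' Tt' <-]] [_ [f Ff [s Ts <-]] <-]] _].
  by apply: generatedB; apply: generatedD; first [exact: TU|exact: FU].
(* By exactness [B] comes from [H], so the generic property of [H] can be applied to its
   preimage. *)
have dZ := definable_subset_preimage S_compact i_ld i_inj Bi dB.
have [Z [dZ' ZU [C [cC CU CZ]]]] := gH _ dZ.
have iB : i @` generated (i @^-1` B) = generated B.
  rewrite -generated_image; congr generated; apply/seteqP.
  split=> [_ [h Bh <-]//|y By]; have [h _ hy] := Bi _ By.
  by exists h => //; rewrite /preimage /= hy.
have BgU : generated B `<=` generated X.
  by apply: generated_sub => //; [exact: generated0|exact: generatedB].
have FgU : generated F `<=` generated X.
  by apply: generated_sub => //; [exact: generated0|exact: generatedB].
have iU h : generated (i @^-1` B) h -> generated X (i h).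
  by move=> Bh; apply: BgU; rewrite -iB; exists h.
exists [set t + h | t in T & h in i @` Z]; split.
- apply: definable_subsetD => //; exact: definable_subset_image.
- by move=> _ [t /TU Ut [_ [h /ZU/iU Uh <-] <-]]; exact: generatedD.
(* The translating set is countable: [F] is finite, so [generated F] is countable, and [C] is
   countable by genericity of [Z]. *)
exists [set f + c | f in generated F & c in i @` C].
have AXU : [set f + c | f in generated F & c in i @` C] `<=` generated X.
  by move=> _ [f /FgU Uf [_ [c /CU/iU Uc <-] <-]]; exact: generatedD.
split=> //.
  apply: countable_image2.
    by apply: countable_generated; exact: finite_set_countable.
  exact: card_le_trans (card_image_le _ _) cC.
apply/seteqP; split.
  move=> _ [a /AXU Ua [_ [t /TU Ut [_ [h /ZU/iU Uh <-] <-]] <-]].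
  by apply: generatedD => //; exact: generatedD.
move=> x Ux.
have [|||f [t [b [Ff Tt + ->]]]] := generated_cover XT _ _ _ Ux (F := F) (B := B).
- exact: iter_difference0.
- by move=> t; exact: iter_differenceN.
- move=> t t' Tt Tt'.
  have [|v A'v [y /YT[s Ts <-] E]] := TTA' (p (t + t')).
    by exists (t + t') => //; exists t => //; exists t'.
  have [_ pv] := liftP _ A'v.
  (* Since [p (t + t')] equals [v + p s], the element [lift v + s] has the same image as [t + t'],
     and their difference belongs to [B]. *)
  exists (lift v), s, (t + t' - (lift v + s)); split=> //.
  + by exists v.
  + split; last by rewrite raddfB -E raddfD pv subrr.
    exists (t + t'); first by exists t => //; exists t'.
    by exists (lift v + s) => //; exists (lift v); [exists v|exists s].
  + by rewrite [RHS]addrC subrK.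
rewrite -iB => -[h + <-]; rewrite -CZ => -[c Cc [z Zz <-]].
(* The [generated B] summand is [i (c + z)]: its part [i c] joins [f] in the countable set, and
   [i z] joins [t] in the generic set. *)
exists (f + i c); first by exists f => //; exists (i c) => //; exists c.
exists (t + i z); first by exists t => //; exists (i z) => //; exists z.
by rewrite raddfD addrACA addrA.
Qed.

End Extension.

Theorem theorem3p4 (L : language) (d : Order.disp_t) (M : orderType d)
    (S : structure L M) (K : Type)
    (K_uncountable : card_lt [set: nat] [set: K])
    (S_omin : o_minimal S) (S_sat : saturated S K)
    (H G V : ldgroup S)
    (i : {additive H -> G}) (p : {additive G -> V})
    (i_ld : locally_definable i) (p_ld : locally_definable p)
    (exact_ip : short_exact i p) :
  generic_property V -> generic_property H -> generic_property G.
Proof.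
have S_compact := saturated_countably_compact K_uncountable S_sat.
exact: (generic_property_extension S_compact i_ld p_ld exact_ip).
Qed.
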